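(* Let $H$ be a complex Hilbert space with $\dim(H)\geq 3$. Then there exists $a\in B(H)$ which is not bilocally unitarily equivalent to its transpose. Furthermore, suppose $K$ is a closed subspace of $H$ with $\dim(K)\geq 3$, and let $p$ denote the orthogonal projection of $H$ onto $K$. Then there exists $a\in B(H)$ with $a=pap$ which is not bilocally unitarily equivalent to its transpose in $B(H)$.
   Context: $B(H)$ denotes the C$^*$-algebra of all bounded linear operators on $H$. For $a\in B(H)$, $a^{t}\in B(H)$ denotes the transpose of $a$ with respect to a fixed orthonormal basis $\{e_i\}_{i\in I}$ of $H$, i.e. the bounded operator with $\langle a^{t}e_j, e_i\rangle = \langle a e_i, e_j\rangle$ for all $i,j\in I$. An operator $a\in B(H)$ is called bilocally unitarily equivalent to its transpose if for every $\xi,\eta\in H$ there exists a unitary $u_{\xi,\eta}\in B(H)$, depending on $\xi$ and $\eta$, such that $$a(\xi)=u_{\xi,\eta}\,a^{t}\,u_{\xi,\eta}^{*}(\xi)\quad\text{and}\quad a(\eta)=u_{\xi,\eta}\,a^{t}\,u_{\xi,\eta}^{*}(\eta).$$ *)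

(* Defs.v *)
From HB Require Import structures.
From mathcomp Require Import all_boot all_order all_algebra.
From mathcomp Require Import complex.
From mathcomp Require Import all_classical all_reals all_analysis.

Set Implicit Arguments.
Unset Strict Implicit.
Unset Printing Implicit Defensive.

Import Order.TTheory GRing.Theory Num.Theory.
Import numFieldNormedType.Exports.

Local Open Scope classical_set_scope.
Local Open Scope ring_scope.

(* The dot product is linear in its first argument and conjugate-linear in its
   second one, and it induces the norm. *)
HB.mixin Record NormedModule_isInnerProduct (R : realType) (H : Type)
    of NormedModule R[i] H := {
  inner : {dot H for @Num.conj R[i]} ;
  inner_norm : forall x : H, `|x| ^+ 2 = inner x x
}.

#[short(type="hilbertType")]
HB.structure Definition Hilbert (R : realType) :=
  {H of CompleteNormedModule R[i] H & NormedModule_isInnerProduct R H}.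

Notation "''[' x , y ]" := (inner x y) : ring_scope.

Record bounded_op (R : realType) (H : hilbertType R) := BoundedOp {
  op :> {linear H -> H} ;
  op_bounded : exists M : R[i], forall x : H, `|op x| <= M * `|x|
}.

Notation "''B' ( H )" := (bounded_op H)
  (at level 8, format "''B' ( H )") : type_scope.

Section HilbertSpaces.
Variables (R : realType) (H : hilbertType R).
Implicit Types (K : set H) (a b p u v : 'B(H)).

Definition linear_span (I : Type) (e : I -> H) : set H :=
  [set x | exists (s : seq I) (c : I -> R[i]), x = \sum_(i <- s) c i *: e i].

Definition orthonormal_basis (I : Type) (e : I -> H) : Prop :=
  [/\ forall i, '[e i, e i] = 1,
      forall i j, i <> j -> '[e i, e j] = 0 &
      closure (linear_span e) = setT].

Definition closed_subspace K : Prop :=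
  [/\ K 0, forall (c : R[i]) x y, K x -> K y -> K (c *: x + y) & closed K].

Definition dim_ge (n : nat) K : Prop :=
  exists w : 'I_n -> H, (forall i, K (w i)) /\
    forall c : 'I_n -> R[i], \sum_(i < n) c i *: w i = 0 -> forall i, c i = 0.

Definition is_orthogonal_projection K p : Prop :=
  forall x, K (p x) /\ forall y, K y -> '[x - p x, y] = 0.

Definition is_adjoint a b : Prop := forall x y, '[a x, y] = '[x, b y].

(* u is unitary, with adjoint v *)
Definition is_unitary_with_adjoint u v : Prop :=
  [/\ is_adjoint u v, cancel u v & cancel v u].

Definition is_transpose (I : Type) (e : I -> H) a b : Prop :=
  forall i j, '[b (e j), e i] = '[a (e i), e j].

(* For an orthonormal basis e, every a has exactly one transpose b in B(H).
   Since b is quantified universally, the negation of this predicate asserts in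
   particular that the transpose exists. *)
Definition bilocally_unitarily_equivalent_to_transpose
    (I : Type) (e : I -> H) a : Prop :=
  forall b, is_transpose e a b ->
  forall xi eta : H, exists u v, is_unitary_with_adjoint u v /\
    (a xi = u (b (v xi)) /\ a eta = u (b (v eta))).

End HilbertSpaces.

(* Main.v *)
Require Import Defs.
From HB Require Import structures.
From mathcomp Require Import all_boot all_order all_algebra.
From mathcomp Require Import complex.
From mathcomp Require Import all_classical all_reals all_analysis.
From mathcomp Require Import ring.

Set Implicit Arguments.
Unset Strict Implicit.

Import Order.TTheory GRing.Theory Num.Theory.
Import numFieldNormedType.Exports.

Local Open Scope classical_set_scope.
Local Open Scope ring_scope.

(** Let f1, f2, f3 be an orthonormal triple (in K, for the second claim) and let
    a be the truncated weighted shift f1 <- f2 <- f3, that is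
    a f3 = 2 f2, a f2 = f1, and a = 0 on the complement of {f2, f3}.  The
    vectors xi = f3 and eta = f2 already refute bilocal equivalence.

    The basis defines an antiunitary conjugation J that fixes each basis vector
    ([exists_conjugation]).  With g_i = J f_i, which is again an orthonormal
    triple, the transpose of a is the shift in the opposite direction:
    b g1 = g2, b g2 = 2 g3, b g3 = 0 ([rank_two_transpose]).

    Both operators have norm 2.  The operator a attains its norm at f3, and
    a (a f3) = 2 f1 is nonzero.  The operator b attains its norm on the line of
    g2 only, and b (b g2) = 0.  If a and u b u* agree at f3 and at f2, then they
    agree at f3 and at a f3.  So u* f3 is a unit vector at which b attains its
    norm, hence a multiple of g2, and b (b (u* f3)) = u* (2 f1) must
    vanish, which is absurd ([truncated_shift_inequivalent]).

    Finally a = pap whenever the f_i lie in the range K of p. *)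

(** * Inner product inequalities *)

Section InnerProduct.
Context {R : realType} {H : hilbertType R}.
Implicit Types (x y z g h : H) (c : R[i]).

Lemma innerC x y : '[x, y] = ('[y, x])^*.
Proof. by rewrite hermC expr0 mul1r. Qed.

Lemma innerDl x y z : '[x + y, z] = '[x, z] + '[y, z].
Proof. exact: linearDl. Qed.

Lemma innerDr x y z : '[z, x + y] = '[z, x] + '[z, y].
Proof. exact: linearDr. Qed.

Lemma innerNl x y : '[- x, y] = - '[x, y].
Proof. exact: linearNl. Qed.

Lemma innerNr x y : '[x, - y] = - '[x, y].
Proof. exact: linearNr. Qed.

Lemma innerZl c x y : '[c *: x, y] = c * '[x, y].
Proof. exact: linearZl_LR. Qed.

Lemma innerZr c x y : '[x, c *: y] = c^* * '[x, y].
Proof. exact: linearZr_LR. Qed.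

Lemma inner0l x : '[0, x] = 0.
Proof. exact: linear0l. Qed.

Lemma inner0r x : '[x, 0] = 0.
Proof. exact: linear0r. Qed.

Lemma inner_suml (I : Type) (s : seq I) (F : I -> H) y :
  '[\sum_(i <- s) F i, y] = \sum_(i <- s) '[F i, y].
Proof. exact: linear_sumlz. Qed.

Definition innerE :=
  (innerDl, innerDr, innerNl, innerNr, innerZl, innerZr, inner0l, inner0r).

(** The difference of the two sides is the squared norm of the component of [x]
    orthogonal to [g] and [h]. *)
Lemma bessel2 x g h : '[g, g] = 1 -> '[h, h] = 1 -> '[g, h] = 0 ->
  `|'[x, g]| ^+ 2 + `|'[x, h]| ^+ 2 <= '[x, x].
Proof.
move=> gg hh gh.
have hg : '[h, g] = 0 by rewrite innerC gh conjC0.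
rewrite -subr_ge0.
suff -> : '[x, x] - (`|'[x, g]| ^+ 2 + `|'[x, h]| ^+ 2) =
    `|x - '[x, g] *: g - '[x, h] *: h| ^+ 2 by rewrite exprn_ge0.
rewrite inner_norm !innerE gg hh gh hg (innerC g x) (innerC h x) !normCK.
ring.
Qed.

(** Up to the factor [`|y| ^+ 2], the difference of the squared sides is the
    squared norm of the component of [x] orthogonal to [y]. *)
Lemma cauchy_schwarz x y : `|'[x, y]| <= `|x| * `|y|.
Proof.
have [->|y0] := eqVneq y 0; first by rewrite inner0r !normr0 mulr0.
have ny0 : `|y| != 0 by rewrite normr_eq0.
rewrite -(@ler_pXn2r _ 2) ?nnegrE ?mulr_ge0// exprMn -subr_ge0.
set c := '[x, y].
suff -> : `|x| ^+ 2 * `|y| ^+ 2 - `|c| ^+ 2 =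
    `|y| ^+ 2 * `|x - (c / `|y| ^+ 2) *: y| ^+ 2.
  by rewrite mulr_ge0// exprn_ge0.
rewrite (inner_norm (x - _)) !innerE -!inner_norm (innerC y x) -/c.
rewrite rmorphM fmorphV rmorphXn /= normCK (CrealP (normr_real y)).
by field.
Qed.

End InnerProduct.

(** * Orthonormal triples *)

Section Orthonormal.
Context {R : realType} {H : hilbertType R}.

(** A homogeneous linear system with fewer equations (the [size s]
    orthogonality conditions) than unknowns (the [n] coefficients on an
    independent family of [K]) has a nonzero solution.  Iterating this replaces
    the Gram-Schmidt process. *)
Lemma exists_orthogonal_unit (n : nat) (K : set H) (s : seq H) :
  K 0 -> (forall (c : R[i]) x y, K x -> K y -> K (c *: x + y)) ->
  dim_ge n K -> (size s < n)%N ->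
  exists x : H, [/\ K x, '[x, x] = 1 & forall y, y \in s -> '[x, y] = 0].
Proof.
move=> K0 Klin [w [Kw w_free]] sn.
pose M : 'M[R[i]]_(n, size s) := \matrix_(i, j) '[w i, s`_j].
have : kermx M != 0.
  rewrite kermx_eq0 /row_free neq_ltn.
  by rewrite (leq_ltn_trans (rank_leq_col M)).
case/rowV0Pn => c /sub_kermxP cM c0.
pose x := \sum_(i < n) c 0 i *: w i.
have Kx : K x.
  rewrite /x; elim/big_ind: _ => // [u v Ku Kv|i _].
    by rewrite -[u]scale1r; exact: Klin.
  by rewrite -[_ *: _]addr0; exact: Klin.
have x0 : x != 0.
  apply: contraNneq c0 => /w_free cw0.
  by apply/eqP/rowP => i; rewrite cw0 mxE.
have nx0 : `|x| != 0 by rewrite normr_eq0.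
have xs y : y \in s -> '[x, y] = 0.
  move=> ys; have := congr1 (fun v : 'rV_(size s) =>
    v 0 (Ordinal (etrans (index_mem y s) ys))) cM.
  rewrite !mxE /= => <-; rewrite /x inner_suml.
  by apply: eq_bigr => i _; rewrite innerZl mxE /= nth_index.
exists (`|x|^-1 *: x); split.
- by rewrite -[_ *: _]addr0; exact: Klin.
- rewrite !innerE -inner_norm fmorphV /= (CrealP (normr_real x)).
  by field.
- by move=> y ys; rewrite innerZl xs// mulr0.
Qed.

Definition orthonormal_triple (f1 f2 f3 : H) : Prop :=
  [/\ '[f1, f1] = 1, '[f2, f2] = 1 & '[f3, f3] = 1] /\
  [/\ '[f1, f2] = 0, '[f1, f3] = 0 & '[f2, f3] = 0].

Lemma exists_orthonormal_triple (K : set H) :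
  K 0 -> (forall (c : R[i]) x y, K x -> K y -> K (c *: x + y)) ->
  dim_ge 3 K ->
  exists f1 f2 f3, [/\ K f1, K f2, K f3 & orthonormal_triple f1 f2 f3].
Proof.
move=> K0 Klin K3.
have [//|f3 [Kf3 f33 _]] := exists_orthogonal_unit (s := [::]) K0 Klin K3.
have [//|f2 [Kf2 f22 f2o]] := exists_orthogonal_unit (s := [:: f3]) K0 Klin K3.
have [//|f1 [Kf1 f11 f1o]] :=
  exists_orthogonal_unit (s := [:: f2; f3]) K0 Klin K3.
exists f1, f2, f3; split => //; split => //.
by split; [apply: f1o|apply: f1o|apply: f2o]; rewrite !inE eqxx ?orbT.
Qed.

End Orthonormal.

(** * The conjugation of an orthonormal basis *)

Section Conjugation.
Context {R : realType} {H : hilbertType R} {I : Type} (e : I -> H).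
Hypothesis e_basis : orthonormal_basis e.

(** The graph of the conjugation on the algebraic span of the basis.  As a
    relation it needs no uniqueness of coefficients; that it is single valued
    follows from [conj_pair_dist]. *)
Inductive conj_pair : H -> H -> Prop :=
| conj_pair0 : conj_pair 0 0
| conj_pairD (c : R[i]) i x y : conj_pair x y ->
    conj_pair (c *: e i + x) (c^* *: e i + y).

(** Inner products of basis vectors are 0 or 1, hence real. *)
Lemma inner_basisC i j : '[e i, e j] = '[e j, e i].
Proof.
case: e_basis => _ e0 _.
by have [->//|ij] := pselect (i = j); rewrite !e0// => ji; exact: ij.
Qed.

Lemma conj_pair_basis i x y : conj_pair x y -> '[y, e i] = '[e i, x].
Proof.
elim=> [|c j x0 y0 _ IH]; rewrite !innerE// IH.
by rewrite inner_basisC.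
Qed.

Lemma conj_pair_inner x y x' y' : conj_pair x y -> conj_pair x' y' ->
  '[y, y'] = '[x', x].
Proof.
move=> xy; elim: xy x' y' => [|c j x0 y0 _ IH] x' y' xy'.
  by rewrite inner0l inner0r.
by rewrite !innerE (IH _ _ xy') innerC (conj_pair_basis _ xy') -innerC.
Qed.

Lemma conj_pair_dist x y x' y' : conj_pair x y -> conj_pair x' y' ->
  `|y - y'| = `|x - x'|.
Proof.
move=> xy xy'; apply/eqP; rewrite -(@eqrXn2 _ 2)//; apply/eqP.
rewrite !inner_norm !innerE (conj_pair_inner xy xy) (conj_pair_inner xy xy').
rewrite (conj_pair_inner xy' xy) (conj_pair_inner xy' xy').
ring.
Qed.

Lemma linear_span_conj_pair x : linear_span e x -> exists y, conj_pair x y.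
Proof.
move=> [s [c ->]]; elim: s => [|i s [y IH]].
  by exists 0; rewrite big_nil; constructor.
by exists ((c i)^* *: e i + y); rewrite big_cons; constructor.
Qed.

(** The closure in [H * H] of the graph [conj_pair]. *)
Definition conj_limit (x y : H) : Prop :=
  forall eps : R[i], 0 < eps -> exists x0 y0,
    [/\ conj_pair x0 y0, `|x - x0| < eps & `|y - y0| < eps].

(** The conjugation is isometric on the dense span, so it extends by
    completeness: the conjugates of the vectors of the span close to [x] form a
    Cauchy filter. *)
Lemma conj_limit_exists x : exists y, conj_limit x y.
Proof.
pose F : set_system H := [set A | exists2 d : R[i], 0 < d &
  forall x0 y0, conj_pair x0 y0 -> `|x - x0| < d -> A y0].
have near_x d : 0 < d -> exists x0 y0, conj_pair x0 y0 /\ `|x - x0| < d.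
  move=> d0; case: e_basis => _ _ e_dense.
  have xe : closure (linear_span e) x by rewrite e_dense.
  have [x0 [ex0 xx0]] := xe _ (nbhsx_ballx x d d0).
  have [y0 xy0] := linear_span_conj_pair ex0.
  by exists x0, y0; split => //; rewrite -ball_normE in xx0.
have FF : ProperFilter F.
  apply: Build_ProperFilter_ex.
    by move=> A [d d0 dA]; have [x0 [y0 [xy0 xd]]] := near_x d d0;
       exists y0; exact: (dA x0).
  split; first by exists 1.
    move=> A B [d d0 dA] [d' d'0 dB].
    have dd' : d >=< d' by apply: real_comparable; apply: gtr0_real.
    exists (Num.min d d'); first by rewrite comparable_lt_min ?d0.
    move=> x0 y0 xy0; rewrite comparable_lt_min// => /andP[? ?].
    by split; [exact: (dA x0)|exact: (dB x0)].
  by move=> A B AB [d d0 dA]; exists d => // x0 y0 xy0 ?; apply/AB/(dA x0).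
have Fcauchy : cauchy_ex F.
  move=> eps eps0; have [x0 [y0 [xy0 xx0]]] :=
    near_x _ (divr_gt0 eps0 (ltr0n _ 2)).
  exists y0; exists (eps / 2) => [|x1 y1 xy1 xx1]; first exact: divr_gt0.
  rewrite -ball_normE /= (conj_pair_dist xy0 xy1).
  rewrite (le_lt_trans (ler_distD x _ _))// (splitr eps) ltrD//.
  by rewrite distrC.
have /cvg_ex [y Fy] : cvg F by apply: cauchy_cvg; exact: cauchy_exP.
exists y => eps eps0.
have [d d0 dy] : F (ball y eps) by apply: Fy; exact: nbhsx_ballx.
have m0 : 0 < Num.min d eps.
  by rewrite comparable_lt_min ?d0// real_comparable// gtr0_real.
have [x0 [y0 [xy0]]] := near_x _ m0.
rewrite comparable_lt_min ?real_comparable ?gtr0_real// => /andP[xd xe].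
by exists x0, y0; split => //; have := dy _ _ xy0 xd; rewrite -ball_normE.
Qed.


(** By continuity of the inner product in one argument, the antiunitarity
    relation with [(x, y)] passes from the graph to its closure.  Applied once
    in each argument, this gives [conj_limit_inner]. *)
Lemma conj_limit_inner_ext x y x' y' :
  (forall x0 y0, conj_pair x0 y0 -> '[y, y0] = '[x0, x]) ->
  conj_limit x' y' -> '[y, y'] = '[x', x].
Proof.
move=> xyP xy'; apply/eqP; rewrite -subr_eq0 -normr_eq0; apply/eqP.
set t := `|_|; set C := `|y| + `|x|.
have C0 : 0 < C + 1 by rewrite ltr_wpDl// addr_ge0.
have bound eps : 0 < eps -> t <= eps * C.
  move=> eps0; have [x0 [y0 [xy0 xx0 yy0]]] := xy' _ eps0.
  have -> : t = `|'[y, y' - y0] - '[x' - x0, x]|.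
    by rewrite /t !innerE (xyP _ _ xy0); congr `|_|; ring.
  rewrite (le_trans (ler_normB _ _))// mulrDr lerD//.
    by rewrite (le_trans (cauchy_schwarz _ _))// mulrC ler_wpM2r// ltW.
  by rewrite (le_trans (cauchy_schwarz _ _))// ler_wpM2r// ltW.
have [//|t0] := eqVneq t 0.
have tpos : 0 < t by rewrite lt_def t0 normr_ge0.
(* With eps = t / (C + 1) the bound reads t <= t * C / (C + 1). *)
have := bound _ (divr_gt0 tpos C0).
by rewrite mulrAC ler_pdivlMr// ler_pM2l// gerDl ler10.
Qed.

Lemma conj_limit_inner x y x' y' : conj_limit x y -> conj_limit x' y' ->
  '[y, y'] = '[x', x].
Proof.
move=> xy; apply: conj_limit_inner_ext => x0 y0 xy0.
rewrite innerC (innerC x0); congr (_^*).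
apply: conj_limit_inner_ext xy => x1 y1; exact: conj_pair_inner.
Qed.

Lemma conj_pair_limit x y : conj_pair x y -> conj_limit x y.
Proof. by move=> xy eps eps0; exists x, y; rewrite !subrr normr0. Qed.

Lemma exists_conjugation : exists J : H -> H,
  (forall x y, '[J x, J y] = '[y, x]) /\
  (forall x i, '[J x, e i] = '[e i, x]).
Proof.
have [J JP] := choice conj_limit_exists.
exists J; split=> [x y|x i]; first exact: conj_limit_inner.
apply: conj_limit_inner (JP x) (conj_pair_limit _).
have := conj_pairD 1 i conj_pair0.
by rewrite conjC1 scale1r addr0.
Qed.

End Conjugation.

(** * Operators of rank two and their transposes *)

Section RankTwo.
Context {R : realType} {H : hilbertType R}.
Variables (k : R[i]) (u v s t : H).

Definition rank_two_fun (x : H) : H := '[x, v] *: u + (k * '[x, t]) *: s.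

Fact rank_two_linear : linear rank_two_fun.
Proof.
move=> c x y.
rewrite /rank_two_fun !innerE !scalerDr !mulrDr !scalerDl !scalerA.
by rewrite addrACA mulrCA.
Qed.

HB.instance Definition _ :=
  GRing.isLinear.Build R[i] H H *:%R rank_two_fun rank_two_linear.

Fact rank_two_bounded : exists M : R[i], forall x : H,
  `|rank_two_fun x| <= M * `|x|.
Proof.
exists (`|v| * `|u| + `|k| * `|t| * `|s|) => x.
rewrite (le_trans (ler_normD _ _))// !normrZ normrM mulrDl lerD//.
  rewrite [leRHS]mulrAC ler_wpM2r// mulrC; exact: cauchy_schwarz.
rewrite [leRHS]mulrAC ler_wpM2r// -mulrA ler_wpM2l// mulrC.
exact: cauchy_schwarz.
Qed.

Definition rank_two : 'B(H) := BoundedOp rank_two_bounded.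

Lemma rank_twoE x : rank_two x = '[x, v] *: u + (k * '[x, t]) *: s.
Proof. by []. Qed.

End RankTwo.

Section TruncatedShift.
Context {R : realType} {H : hilbertType R}.

(** The transpose is the adjoint conjugated by [J].  Taking the adjoint exchanges
    the two vectors of each rank-one summand, and [J] then acts on each. *)
Lemma rank_two_transpose (I : Type) (e : I -> H) (J : H -> H)
    (k : R[i]) (u v s t : H) :
  (forall x i, '[J x, e i] = '[e i, x]) ->
  is_transpose e (rank_two k u v s t) (rank_two k (J v) (J u) (J t) (J s)).
Proof.
move=> Je i j; rewrite !rank_twoE !innerE !Je.
rewrite (innerC (e j) (J u)) (innerC (e j) (J s)) !Je -!innerC.
ring.
Qed.

(** * A truncated weighted shift and its transpose *)

(** The two weights 1 and 2 must have different moduli: with equal moduli the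
    shift would be unitarily equivalent to its transpose. *)
Definition truncated_shift (f1 f2 f3 : H) : 'B(H) := rank_two 2 f1 f2 f2 f3.

(** The equation at [f3] forces [v f3] into the line of [g2], the only one on
    which [b] attains its norm; then [v f2], which is half of [b (v f3)], lies
    in the line of [g3], the kernel of [b] within the span of the triple.  The
    equation at [f2] then gives [v f1 = 0], although [v] is isometric. *)
Lemma truncated_shift_inequivalent (f1 f2 f3 g1 g2 g3 : H) (u v : 'B(H)) :
  orthonormal_triple f1 f2 f3 -> orthonormal_triple g1 g2 g3 ->
  is_unitary_with_adjoint u v ->
  let a := truncated_shift f1 f2 f3 in
  let b := rank_two 2 g2 g1 g3 g2 in
  a f3 = u (b (v f3)) -> a f2 = u (b (v f2)) -> False.
Proof.
move=> [[f11 f22 f33] [f12 f13 f23]] [[g11 g22 g33] [g12 g13 g23]].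
move=> [uv uK vK] a b.
have f32 : '[f3, f2] = 0 by rewrite innerC f23 conjC0.
have g32 : '[g3, g2] = 0 by rewrite innerC g23 conjC0.
have g31 : '[g3, g1] = 0 by rewrite innerC g13 conjC0.
have v_isom x y : '[v x, v y] = '[x, y] by rewrite -uv vK.
have -> : a f3 = 2 *: f2 by rewrite rank_twoE f32 f33 scale0r add0r mulr1.
have -> : a f2 = f1 by rewrite rank_twoE f22 f23 mulr0 scale0r addr0 scale1r.
move=> /(congr1 v); rewrite uK linearZ_LR => b3.
move=> /(congr1 v); rewrite uK => b2.
set p := '[v f3, g1]; set q := '[v f3, g2].
have b3E : b (v f3) = p *: g2 + 2 *: (q *: g3) by rewrite rank_twoE scalerA.
have pq_le1 : `|p| ^+ 2 + `|q| ^+ 2 <= 1.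
  by rewrite -f33 -v_isom; exact: bessel2.
have pq4 : `|p| ^+ 2 + 4 * `|q| ^+ 2 = 4.
  have : '[b (v f3), b (v f3)] = 4.
    by rewrite -b3 !innerE v_isom f22 rmorph_nat; ring.
  rewrite b3E !innerE g22 g33 g23 g32 rmorph_nat !normCK => b3_4.
  rewrite -[RHS]b3_4.
  ring.
(* 3 |p|^2 = 4 (|p|^2 + |q|^2) - (|p|^2 + 4 |q|^2) <= 4 - 4. *)
have p0 : p = 0.
  have p2 : 3 * `|p| ^+ 2 <= 0.
    have -> : 3 * `|p| ^+ 2 = 4 * (`|p| ^+ 2 + `|q| ^+ 2) - 4.
      by rewrite -[X in _ - X]pq4; ring.
    by rewrite subr_le0 -[leRHS]mulr1 ler_wpM2l.
  apply/eqP; rewrite -normr_eq0 -sqrf_eq0 eq_le exprn_ge0// andbT.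
  by rewrite -(@pmulr_rle0 _ 3).
have vf2 : v f2 = q *: g3.
  apply: (@scalerI _ _ (2 : R[i])); first by rewrite pnatr_eq0.
  by rewrite b3 b3E p0 scale0r add0r.
have vf1 : v f1 = 0.
  by rewrite b2 vf2 linearZ_LR rank_twoE g31 g32 mulr0 !scale0r addr0 scaler0.
have := v_isom f1 f1; rewrite vf1 inner0l f11 => /eqP.
by rewrite eq_sym oner_eq0.
Qed.

Lemma truncated_shift_not_bilocal (I : Type) (e : I -> H) (f1 f2 f3 : H) :
  orthonormal_basis e -> orthonormal_triple f1 f2 f3 ->
  ~ bilocally_unitarily_equivalent_to_transpose e (truncated_shift f1 f2 f3).
Proof.
move=> e_basis f_on bilocal.
have [J [J_inner Je]] := exists_conjugation e_basis.
have [u [v [uv [a3 a2]]]] :=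
  bilocal _ (rank_two_transpose 2 f1 f2 f2 f3 Je) f3 f2.
have Jf_on : orthonormal_triple (J f1) (J f2) (J f3).
  case: f_on => [[f11 f22 f33] [f12 f13 f23]].
  split; split; rewrite J_inner// innerC ?f12 ?f13 ?f23 conjC0//.
exact: truncated_shift_inequivalent f_on Jf_on uv a3 a2.
Qed.

Lemma projection_id (K : set H) (p : 'B(H)) x :
  closed_subspace K -> is_orthogonal_projection K p -> K x -> p x = x.
Proof.
move=> [K0 Klin _] pK Kx; apply/eqP; rewrite eq_sym -subr_eq0 -normr_eq0.
have [Kpx pxo] := pK x; rewrite -sqrf_eq0 inner_norm pxo//.
by rewrite addrC -scaleN1r; exact: Klin.
Qed.

End TruncatedShift.

Unset Implicit Arguments.
Set Strict Implicit.

Theorem theorem2p1 (R : realType) (H : hilbertType R)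
  (I : Type) (e : I -> H) (he : orthonormal_basis e)
  (hH : dim_ge 3 [set: H]) :
  (exists a : 'B(H), ~ bilocally_unitarily_equivalent_to_transpose e a) /\
  (forall (K : set H) (p : 'B(H)),
     closed_subspace K -> dim_ge 3 K -> is_orthogonal_projection K p ->
     exists a : 'B(H), (forall x : H, a x = p (a (p x))) /\
       ~ bilocally_unitarily_equivalent_to_transpose e a).
Proof.
split.
  have [f1 [f2 [f3 [_ _ _ f_on]]]] :=
    exists_orthonormal_triple (K := setT) Logic.I (fun _ _ _ _ _ => Logic.I) hH.
  by exists (truncated_shift f1 f2 f3); exact: truncated_shift_not_bilocal.
move=> K p Ksub K3 pK.
have [K0 Klin _] := Ksub.
have [f1 [f2 [f3 [Kf1 Kf2 Kf3 f_on]]]] := exists_orthonormal_triple K0 Klin K3.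
exists (truncated_shift f1 f2 f3).
split; last exact: truncated_shift_not_bilocal.
have inner_p x y : K y -> '[p x, y] = '[x, y].
  move=> Ky; apply/eqP; rewrite eq_sym -subr_eq0 -innerNl -innerDl.
  by rewrite (pK x).2.
move=> x; rewrite (projection_id Ksub pK) !rank_twoE !inner_p//.
by apply: (Klin) => //; rewrite -[_ *: _]addr0; exact: Klin.
Qed.
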